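(* Let $p\ge1$ and $D>0$. The empirical global Rademacher complexity of the multi-kernel class $H_p=H_{p,D,M}$ satisfies, for all $t\ge p$, $$\widehat{R}(H_p)\le D\,\sqrt{\frac{t^*}{n}\Big\|\big(\mathrm{tr}(K_m)\big)_{m=1}^M\Big\|_{\frac{t^*}{2}}}\,.$$
   Context: Let $M,n\ge 1$ be integers, let $\mathcal{H}_1,\dots,\mathcal{H}_M$ be (reproducing kernel) Hilbert spaces of kernels $k_1,\dots,k_M$, and put $\mathcal{H}=\mathcal{H}_1\times\cdots\times\mathcal{H}_M$ with the inner product $\langle \boldsymbol{u},\boldsymbol{v}\rangle=\sum_m\langle \boldsymbol{u}^{(m)},\boldsymbol{v}^{(m)}\rangle$. Let $\boldsymbol{x}_1,\dots,\boldsymbol{x}_n\in\mathcal{H}$ be the sample (feature-space images of the inputs), $\boldsymbol{x}_i=(\boldsymbol{x}_i^{(1)},\dots,\boldsymbol{x}_i^{(M)})$. For $\boldsymbol{w}\in\mathcal{H}$ let $\|\boldsymbol{w}\|_{2,p}=\big\|(\|\boldsymbol{w}^{(m)}\|_{\mathcal{H}_m})_{m=1}^M\big\|_p$, $f_{\boldsymbol{w}}(\boldsymbol{x})=\langle\boldsymbol{w},\boldsymbol{x}\rangle$, and $H_{p,D,M}=\{f_{\boldsymbol{w}}:\ \|\boldsymbol{w}\|_{2,p}\le D\}$. The empirical global Rademacher complexity is $$\widehat{R}(H_p)=\mathbb{E}_{\sigma}\sup_{f_{\boldsymbol{w}}\in H_p}\Big\langle\boldsymbol{w},\frac1n\sum_{i=1}^n\sigma_i\boldsymbol{x}_i\Big\rangle,$$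 with $\sigma_1,\dots,\sigma_n$ i.i.d. Rademacher signs and the sample held fixed. $K_m$ is the normalized Gram matrix with entries $\frac1n\langle\boldsymbol{x}_i^{(m)},\boldsymbol{x}_j^{(m)}\rangle$, so $\mathrm{tr}(K_m)=\frac1n\sum_{i=1}^n\|\boldsymbol{x}_i^{(m)}\|^2$. $t^*\in[1,\infty]$ is the conjugate exponent of $t$: $1/t+1/t^*=1$. For $0<s<\infty$ and $a\in\mathbb{R}_+^M$, $\|a\|_s=(\sum_m a_m^s)^{1/s}$ (also when $s<1$). If $t=1$ ($t^*=\infty$) the right-hand side is read as $+\infty$. *)

(* Defs.v *)
From HB Require Import structures.
From mathcomp Require Import all_boot all_order all_algebra.
From mathcomp Require Import all_classical all_reals all_analysis.
Import Order.TTheory GRing.Theory Num.Theory.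
Import numFieldNormedType.Exports.

Set Implicit Arguments.
Unset Strict Implicit.
Unset Printing Implicit Defensive.

Local Open Scope classical_set_scope.
Local Open Scope ring_scope.

(* A real Hilbert space: a Banach space whose norm comes from an inner product.
   Over the reals, a Hermitian form for the identity automorphism is a
   symmetric bilinear form. *)
Record hilbertType (R : realType) := HilbertType {
  hilbert_sort :> completeNormedModType R ;
  hdot : {dot hilbert_sort for (@idfun R)} ;
  hdot_norm : forall u : hilbert_sort, hdot u u = `|u| ^+ 2 }.

(* For 0 < s < oo this is (sum_m |a_m|^s)^(1/s), including s < 1, where it is
   only a quasi-norm; for s = +oo it is the maximum. The value at -oo is junk. *)
Definition lnorm (R : realType) (M : nat) (s : \bar R) (a : 'I_M -> R) : R :=
  match s with
  | r%:E => (\sum_(m < M) `|a m| `^ r) `^ r^-1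
  | +oo%E => \big[Num.max/0]_(m < M) `|a m|
  | -oo%E => 0
  end.

Section multi_kernel.
Variables (R : realType) (M : nat) (H : 'I_M -> hilbertType R).

Local Notation HM := (forall m : 'I_M, H m).

Definition prod_dot (u v : HM) : R := \sum_(m < M) hdot (H m) (u m) (v m).

Definition norm2 (p : \bar R) (w : HM) : R := lnorm p (fun m => `|w m|).

Definition linear_predictor (w : HM) : HM -> R := fun x => prod_dot w x.

Definition multi_kernel_class (p : \bar R) (D : R) : set (HM -> R) :=
  [set linear_predictor w | w in [set w : HM | norm2 p w <= D]].

Variable (n : nat) (x : 'I_n -> HM).

Definition signed_mean (s : 'I_n -> R) : HM :=
  fun m => n%:R^-1 *: \sum_(i < n) s i *: x i m.

Definition normalized_gram (m : 'I_M) : 'M[R]_n :=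
  \matrix_(i, j) (n%:R^-1 * hdot (H m) (x i m) (x j m)).

End multi_kernel.

Arguments multi_kernel_class {R M} H p D.

Section rademacher.
Variables (R : realType) (d : measure_display) (T : measurableType d).
Variable P : probability T R.

Definition rademacher_variable (X : {RV P >-> R}) : Prop :=
  P (X @^-1` [set 1]) = (2^-1)%:E /\ P (X @^-1` [set -1]) = (2^-1)%:E.

Definition mutually_independent (n : nat) (X : 'I_n -> {RV P >-> R}) : Prop :=
  forall (J : {set 'I_n}) (B : 'I_n -> set R),
    (forall i, measurable (B i)) ->
    P (\bigcap_(i in [set` J]) (X i @^-1` B i)) =
    (\prod_(i in J) P (X i @^-1` B i))%E.

Definition rademacher_signs (n : nat) (sigma : 'I_n -> {RV P >-> R}) : Prop :=
  (forall i, rademacher_variable (sigma i)) /\ mutually_independent sigma.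

(* Both the supremum and the expectation are taken in the extended reals, so
   that no boundedness or integrability is presupposed. *)
Definition empirical_rademacher (M n : nat) (H : 'I_M -> hilbertType R)
    (sigma : 'I_n -> {RV P >-> R}) (x : 'I_n -> forall m, H m)
    (F : set ((forall m, H m) -> R)) : \bar R :=
  (\int[P]_omega ereal_sup
     [set (f (signed_mean x (fun i => sigma i omega)))%:E | f in F])%E.

End rademacher.

(* Main.v *)
Require Import Defs.
From HB Require Import structures.
From mathcomp Require Import all_boot all_order all_algebra.
From mathcomp Require Import all_classical all_reals all_analysis.
From mathcomp Require Import measurable_realfun ring lra.
Import Order.TTheory GRing.Theory Num.Theory.
Import numFieldNormedType.Exports.

Set Implicit Arguments.
Unset Strict Implicit.
Unset Printing Implicit Defensive.

Local Open Scope classical_set_scope.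
Local Open Scope ring_scope.

(* Hoelder's inequality for the pair (t, t^* ), together with
   ||w||_{2,t} <= ||w||_{2,p}, bounds the supremum by D ||u||_{2,t^*}, where u
   is the signed mean of the sample. By Jensen's inequality it then suffices to
   prove, in each Hilbert space, the Khintchine-Kahane inequality
   E ||S||^s <= (s V)^(s/2), with S = sum_i sigma_i x_i, V = sum_i ||x_i||^2 and
   s = t^* >= 1. Pairing every sign vector with its flip in one coordinate gives
   E ||S||^(r+2) <= (k+1) V E ||S||^r for every integer k >= r >= 0, the discrete
   analogue of Gaussian integration by parts. For s >= 2 take r = s - 2 and
   k + 1 <= s, and bound E ||S||^(s-2) by (E ||S||^s)^((s-2)/s); for s < 2
   interpolate from E ||S||^2 <= V. *)

(** * A two-point inequality for powers *)

Section two_point.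
Variable R : realType.
Implicit Types (a b r : R) (k : nat).

Lemma two_point_exprn a b k : 0 <= b -> b <= a ->
  (a + b) * (a ^+ k - b ^+ k) <= k%:R * ((a - b) * (a ^+ k + b ^+ k)).
Proof.
move=> b0 ba; have a0 := le_trans b0 ba.
elim: k => [|k IH]; first by rewrite !expr0; lra.
have h : 0 <= (a - b) * (a ^+ k - b ^+ k).
  by rewrite mulr_ge0 ?subr_ge0// lerXn2r ?nnegrE.
have h2 : 0 <= k.+1%:R * (a - b) * ((a - b) * (a ^+ k - b ^+ k)).
  by apply: mulr_ge0 => //; rewrite mulr_ge0 ?subr_ge0.
have h3 : (a + b) * ((a + b) * (a ^+ k - b ^+ k)) <=
    (a + b) * (k%:R * ((a - b) * (a ^+ k + b ^+ k))).
  by rewrite ler_wpM2l ?addr_ge0.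
(* With [p = a ^+ k] and [q = b ^+ k], the addition formulas [2 (a p - b q) = (a + b) (p - q) + (a -
   b) (p + q)] and [2 (a p + b q) = (a + b) (p + q) + (a - b) (p - q)] reduce the goal to [h2] and
   [h3]. *)
rewrite !exprS; rewrite -!natr1 in h2 *.
move: (a ^+ k) (b ^+ k) (k%:R : R) h2 h3 => p q c h2 h3.
by nra.
Qed.

(* For [a = e^h] and [b = e^-h] this is [tanh (r h) <= k tanh h], from the
   monotonicity of tanh and, for integer exponents, its subadditivity. *)
Lemma two_point_powR a b r k : 0 <= a -> 0 <= b -> 0 <= r -> r <= k%:R ->
  (a ^+ 2 - b ^+ 2) * (a `^ r - b `^ r) <=
  k%:R * ((a - b) ^+ 2 * (a `^ r + b `^ r)).
Proof.
wlog ba : a b / b <= a.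
  move=> W a0 b0 r0 rk; have [ba|/ltW ab] := leP b a; first exact: W.
  by have := W b a ab b0 a0 r0 rk; lra.
move=> a0 b0 r0 rk.
have := two_point_exprn k b0 ba.
(* This is [(b / a) ^ k <= (b / a) ^ r], true since [b <= a] and [r <= k], cleared of denominators
   so that zero is covered. Cross-multiplied in [X], it is the monotonicity of tanh. *)
have pq : a `^ r * b ^+ k <= a ^+ k * b `^ r.
  move: b0 ba; rewrite le_eqVlt => /predU1P[<- _|b0 ba].
    move: r0 rk; rewrite le_eqVlt => /predU1P[<- _|r0 rk].
      by rewrite !powRr0 mul1r mulr1 lerXn2r ?nnegrE.
    have k0 : (0 < k)%N by rewrite -(ltr0n R) (lt_le_trans r0).
    by rewrite powR0 ?gt_eqF// expr0n gtn_eqF// !mulr0.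
  have a1 : 0 < a := lt_le_trans b0 ba.
  have E c : 0 < c -> c ^+ k = c `^ (k%:R - r) * c `^ r.
    move=> c0; rewrite -powRD ?subrK ?powR_mulrn ?(ltW c0)//.
    by rewrite (gt_eqF c0) implybT.
  rewrite (E _ b0) (E _ a1) mulrCA mulrA ler_wpM2r ?powR_ge0//.
  rewrite ler_wpM2r ?powR_ge0// ge0_ler_powR ?nnegrE ?subr_ge0//; exact: ltW.
have [->|ab] := eqVneq a b => H; first by rewrite !subrr expr0n/= !mul0r mulr0.
have {}ab : 0 < a - b by rewrite subr_gt0 lt_neqAle eq_sym ab.
have akb : 0 < a ^+ k + b ^+ k.
  by rewrite ltr_wpDr ?exprn_ge0// exprn_gt0; lra.
rewrite -(ler_pM2r akb).
have X : (a `^ r - b `^ r) * (a ^+ k + b ^+ k) <=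
    (a ^+ k - b ^+ k) * (a `^ r + b `^ r).
  by move: (a `^ r) (b `^ r) (a ^+ k) (b ^+ k) pq; clear; move=> p q u v; nra.
have c1 : 0 <= (a - b) * (a + b) by apply: mulr_ge0; [exact: ltW|exact: addr_ge0].
have c2 : 0 <= (a - b) * (a `^ r + b `^ r).
  by apply: mulr_ge0; [exact: ltW|rewrite addr_ge0 ?powR_ge0].
have := lerD (ler_wpM2l c1 X) (ler_wpM2l c2 H).
move: (a `^ r) (b `^ r) (a ^+ k) (b ^+ k) (k%:R : R) => p q u v c le_pq.
rewrite -subr_ge0 in le_pq; rewrite -subr_ge0; apply: le_trans le_pq _.
by rewrite le_eqVlt; apply/orP; left; apply/eqP; ring.
Qed.

End two_point.

(** * Jensen's inequality for concave powers over a finite set *)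

Section power_mean.
Variable R : realType.

(* The concave power lies below its tangent at the mean. *)
Lemma power_mean (I : finType) (f : I -> R) (r : R) :
  (0 < #|I|)%N -> (forall i, 0 <= f i) -> 0 <= r <= 1 ->
  #|I|%:R^-1 * \sum_i f i `^ r <= (#|I|%:R^-1 * \sum_i f i) `^ r.
Proof.
move=> I0 f0 /andP[r0 r1]; set N : R := #|I|%:R.
have N0 : 0 < N by rewrite ltr0n.
have sum1 : N^-1 * \sum_(i : I) 1 = 1 :> R.
  by rewrite sumr_const mulVf// gt_eqF.
set A := N^-1 * \sum_i f i.
have A0 : 0 <= A by apply: mulr_ge0; [rewrite invr_ge0 ltW|exact: sumr_ge0].
have AE : N^-1 * \sum_i f i = A by [].
clearbody A.
move: r0; rewrite le_eqVlt => /predU1P[<-|r0].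
  by under eq_bigr do rewrite powRr0; rewrite sum1 powRr0.
move: A0; rewrite le_eqVlt => /predU1P[A0|A0].
  have fi i : f i = 0.
    apply/eqP; have /eqP := AE; rewrite -A0 mulf_eq0 invr_eq0 (gt_eqF N0)/=.
    by rewrite psumr_eq0// => /allP/(_ i); rewrite mem_index_enum => /(_ isT).
  rewrite -A0 powR0 ?gt_eqF// big1 ?mulr0// => i _.
  by rewrite fi powR0// gt_eqF.
have tangent i : f i `^ r <= A `^ r * (1 - r + r * (A^-1 * f i)).
  rewrite -{1}[f i](mulVKf (lt0r_neq0 A0)) powRM ?mulr_ge0 ?invr_ge0 ?(ltW A0)//.
  rewrite ler_wpM2l ?powR_ge0//.
  have y0 : 0 <= A^-1 * f i by rewrite mulr_ge0 ?invr_ge0 ?(ltW A0).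
  move: (A^-1 * f i) y0 => y y0.
  move: r1; rewrite le_eqVlt => /predU1P[->|r1].
    by rewrite powRr1//; lra.
  have s0 : 0 < 1 - r by rewrite subr_gt0.
  (* Young's inequality for [y ^ r] and [1], with exponents [1 / r] and [1 / (1 - r)], is the
     tangent bound [y ^ r <= r y + 1 - r]. *)
  have := @conjugate_powR R (y `^ r) 1 r^-1 (1 - r)^-1.
  rewrite powR_ge0 ler01 !invr_gt0 !invrK s0 r0 => /(_ isT isT isT isT).
  rewrite mulr1 -powRrM divff ?gt_eqF// powR1 powRr1// mul1r.
  by move/(_ (subrKC _ _)); lra.
apply: (@le_trans _ _ (N^-1 * \sum_i A `^ r * (1 - r + r * (A^-1 * f i)))).
  rewrite ler_wpM2l ?invr_ge0 ?(ltW N0)//; apply: ler_sum => i _; exact: tangent.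
rewrite -mulr_sumr mulrCA -[leRHS]mulr1 ler_wpM2l ?powR_ge0//.
rewrite big_split/= -[\sum_i (1 - r)](_ : (1 - r) * \sum_(i : I) 1 = _); last first.
  by rewrite mulr_sumr; apply: eq_bigr => i _; rewrite mulr1.
rewrite -!mulr_sumr mulrDr mulrCA sum1.
rewrite [N^-1 * (r * _)]mulrCA [N^-1 * (_ * _)]mulrCA AE mulVf ?gt_eqF//; lra.
Qed.

End power_mean.

(** * Inner product estimates in one Hilbert space *)

Section hilbert.
Variables (R : realType) (H : hilbertType R).
Implicit Types u v y : H.

Lemma hdotC u v : hdot H u v = hdot H v u.
Proof. by rewrite (hermC (hdot H)) expr0 mul1r. Qed.

Lemma hdotZr (a : R) u v : hdot H u (a *: v) = a * hdot H u v.
Proof. by rewrite linearZr_LR. Qed.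

Lemma normD_sqr u v : `|u + v| ^+ 2 = `|u| ^+ 2 + 2 * hdot H u v + `|v| ^+ 2.
Proof.
by rewrite -!hdot_norm linearDl/= linearDr/= linearDr/= (hdotC v u); ring.
Qed.

(** Cauchy-Schwarz is read off from the square of the triangle inequality, which the norm already
    satisfies. *)
Lemma hdot_le_norm u v : hdot H u v <= `|u| * `|v|.
Proof.
have : `|u + v| ^+ 2 <= (`|u| + `|v|) ^+ 2.
  by rewrite lerXn2r ?nnegrE ?addr_ge0// ler_normD.
by rewrite normD_sqr sqrrD -mulr_natl; lra.
Qed.

(** With [v = u - 2 *: y], polarization gives [hdot y u = d + |y|^2] and [hdot y v = d - |y|^2],
    where [d = (|u|^2 - |v|^2) / 4]. The [|y|^2] terms contribute 1 to the factor [k.+1]. The [d]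
    terms contribute [k], by the two-point inequality and [(|u| - |v|)^2 <= 4 |y|^2]. *)
Lemma hdot_two_point u y (r : R) (k : nat) : 0 <= r -> r <= k%:R ->
  hdot H y u * `|u| `^ r - hdot H y (u - 2 *: y) * `|u - 2 *: y| `^ r <=
  k.+1%:R * `|y| ^+ 2 * (`|u| `^ r + `|u - 2 *: y| `^ r).
Proof.
move=> r0 rk; set v := u - 2 *: y.
have dv : hdot H y v = hdot H y u - 2 * `|y| ^+ 2.
  by rewrite linearBr/= hdotZr hdot_norm.
have nv : `|v| ^+ 2 = `|u| ^+ 2 - 4 * hdot H y u + 4 * `|y| ^+ 2.
  rewrite /v -scaleNr normD_sqr hdotZr (hdotC u) normrZ normrN ger0_norm//; ring.
have tri : (`|u| - `|v|) ^+ 2 <= 4 * `|y| ^+ 2.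
  rewrite -real_normK ?num_real// (_ : 4 * _ = (2 * `|y|) ^+ 2); last by ring.
  rewrite lerXn2r ?nnegrE ?mulr_ge0// (le_trans (ler_dist_dist _ _))//.
  by rewrite /v opprB addrCA subrr addr0 normrZ ger0_norm.
have := two_point_powR (normr_ge0 u) (normr_ge0 v) r0 rk.
have := @ler_wpM2r _ (k%:R * (`|u| `^ r + `|v| `^ r)) _ _ _ tri.
rewrite mulr_ge0 ?addr_ge0 ?powR_ge0// => /(_ isT).
rewrite nv dv -[k.+1%:R]natr1.
move: (`|u| `^ r) (`|v| `^ r) (k%:R : R) => p q c.
move: (hdot H y u) (`|y|) (`|u|) (`|v|) => a b e f.
by move=> *; lra.
Qed.

End hilbert.

(** * Moments of signed sums: the Khintchine-Kahane inequality *)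

Section khintchine.
Variables (R : realType) (H : hilbertType R) (n : nat) (x : 'I_n -> H).
Local Notation signs := {ffun 'I_n -> bool}.
Implicit Types e : signs.

Definition signed_sum e : H := \sum_(i < n) (-1) ^+ e i *: x i.

Definition flip (i : 'I_n) e : signs := [ffun j => e j (+) (j == i)].

Lemma flipK i : involutive (flip i).
Proof. by move=> e; apply/ffunP => j; rewrite !ffunE -addbA addbb addbF. Qed.

Lemma signed_sum_flip i e :
  signed_sum (flip i e) = signed_sum e - 2 *: ((-1) ^+ e i *: x i).
Proof.
rewrite /signed_sum (bigD1 i)//= [in RHS](bigD1 i)//= ffunE eqxx addbT.
under eq_bigr => j ji do rewrite ffunE (negbTE ji) addbF.
rewrite addrAC; congr (_ + _).
by rewrite signrN scaleNr scaler_nat mulr2n opprD addrA subrr sub0r.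
Qed.

(* Integration by parts for signs: pair each sign vector with its flip at [i]. *)
Lemma signed_sum_moment_step (r : R) (k : nat) : 0 <= r -> r <= k%:R ->
  \sum_e `|signed_sum e| `^ (r + 2) <=
  k.+1%:R * (\sum_i `|x i| ^+ 2) * \sum_e `|signed_sum e| `^ r.
Proof.
move=> r0 rk.
pose g i e := hdot H ((-1) ^+ e i *: x i) (signed_sum e) * `|signed_sum e| `^ r.
(* Two of the [r + 2] factors form the inner product of the signed sum with itself, and only its
   left argument is expanded. *)
have expand e : `|signed_sum e| `^ (r + 2) = \sum_i g i e.
  rewrite powRD; last by apply/implyP; rewrite gt_eqF//; lra.
  rewrite mulrC powR_mulrn// -hdot_norm {1}/signed_sum (linear_sumlz (hdot H))/=.
  by rewrite mulr_suml.
under eq_bigr do rewrite expand.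
rewrite exchange_big/= -mulrA mulr_suml mulr_sumr; apply: ler_sum => i _.
rewrite -(ler_pM2l (@ltr0n R 2)).
have refl (F : signs -> R) : 2 * \sum_e F e = \sum_e (F e + F (flip i e)).
  rewrite big_split/= [X in _ + X](_ : _ = \sum_e F e); first by ring.
  by rewrite [RHS](reindex_inj (inv_inj (flipK i))).
rewrite 2!(mulrCA 2) !refl mulrA mulr_sumr; apply: ler_sum => e _.
rewrite /g ffunE eqxx addbT signed_sum_flip signrN scaleNr linearNl/= mulNr.
have := hdot_two_point (signed_sum e) ((-1) ^+ e i *: x i) r0 rk.
by rewrite normrZ normr_sign mul1r.
Qed.

Lemma khintchine (s : R) : 1 <= s ->
  #|{: signs}|%:R^-1 * \sum_e `|signed_sum e| `^ s <=
  (s * \sum_i `|x i| ^+ 2) `^ (s / 2).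
Proof.
move=> s1; set V := \sum_i `|x i| ^+ 2; set N : R := #|_|%:R.
have s0 : 0 < s by lra.
have V0 : 0 <= V by apply: sumr_ge0.
have c0 : (0 < #|{: signs}|)%N by apply/card_gt0P; exists [ffun=> false].
have N0 : 0 < N by rewrite ltr0n.
have pm (q r : R) : 0 <= r -> r <= q -> 0 < q ->
    N^-1 * \sum_e `|signed_sum e| `^ r <=
    (N^-1 * \sum_e `|signed_sum e| `^ q) `^ (r / q).
  move=> r0 rq q0.
  have := @power_mean R signs (fun e => `|signed_sum e| `^ q) (r / q) c0.
  rewrite divr_ge0 ?(ltW q0)//= ler_pdivrMr// mul1r.
  move=> /(_ (fun=> powR_ge0 _ _) rq).
  under eq_bigr do rewrite -powRrM mulrCA divff ?gt_eqF// mulr1.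
  exact.
have step (r : R) (k : nat) : 0 <= r -> r <= k%:R ->
    N^-1 * \sum_e `|signed_sum e| `^ (r + 2) <=
    k.+1%:R * V * (N^-1 * \sum_e `|signed_sum e| `^ r).
  move=> r0 rk; rewrite mulrCA ler_pM2l ?invr_gt0//.
  exact: signed_sum_moment_step.
have [s2|s2] := ltP s 2.
  apply: le_trans (pm 2 s (ltW s0) (ltW s2) (ltr0Sn R 1)) _.
  rewrite ge0_ler_powR ?nnegrE ?divr_ge0 ?mulr_ge0 ?invr_ge0 ?(ltW N0) ?(ltW s0)//.
    by apply: sumr_ge0 => e _; exact: powR_ge0.
  (* Zeroth powers are all 1, even at a vanishing sum, so [r = k = 0] bounds the second moment by
     [V], and [V <= s * V]. *)
  have := step 0 0 (lexx _) (lexx _).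
  under [X in _ <= _ * (_ * X) -> _]eq_bigr do rewrite powRr0.
  rewrite add0r sumr_const mulVf ?gt_eqF// mul1r mulr1 => /le_trans; apply.
  by rewrite ler_peMl.
(* One above the integer part of [s - 2]: this [k] exceeds [s - 2], while [k + 1] stays at most
   [s]. *)
pose k := (Num.truncn (s - 2)).+1.
have /andP[ks sk] : (Num.truncn (s - 2))%:R <= s - 2 < k%:R.
  by rewrite truncn_itv// subr_ge0.
have {}ks : k.+1%:R <= s by rewrite -natr1 /k -natr1; lra.
have s20 : 0 <= s - 2 by rewrite subr_ge0.
have := step (s - 2) k s20 (ltW sk).
rewrite subrK; set A := N^-1 * _ => stepA.
have A0 : 0 <= A.
  apply: mulr_ge0; first by rewrite invr_ge0 ltW.
  by apply: sumr_ge0 => e _; exact: powR_ge0.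
move: A0; rewrite le_eqVlt => /predU1P[<-|A0]; first exact: powR_ge0.
have Ar0 : 0 < A `^ ((s - 2) / s) by exact: powR_gt0.
(* The moment [A] bounds itself through a smaller power; dividing by that power leaves
   [A ^ (2 / s) <= s V]. *)
have : A <= s * V * A `^ ((s - 2) / s).
  apply: le_trans stepA _; apply: ler_pM.
  - by rewrite mulr_ge0.
  - apply: mulr_ge0; first by rewrite invr_ge0 ltW.
    by apply: sumr_ge0 => e _; exact: powR_ge0.
  - by rewrite ler_wpM2r.
  - by apply: pm => //; lra.
rewrite -ler_pdivrMr// -{1}[A]powRr1 ?(ltW A0)// -powRB ?(gt_eqF A0) ?implybT//.
rewrite (_ : 1 - (s - 2) / s = 2 / s); last by field; rewrite gt_eqF.
move=> h; have -> : A = (A `^ (2 / s)) `^ (s / 2).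
  rewrite -powRrM (_ : 2 / s * (s / 2) = 1) ?powRr1 ?(ltW A0)//.
  by field; rewrite gt_eqF.
rewrite ge0_ler_powR ?nnegrE ?powR_ge0//; last by rewrite mulr_ge0// ltW.
by rewrite divr_ge0 ?ltW.
Qed.


End khintchine.

(** * Hoelder's inequality between the primal ball and the dual norm *)

Section hoelder.
Variables (R : realType) (M : nat).
Implicit Types (a b : 'I_M -> R) (p t : \bar R) (D r s : R).

Lemma lnorm_ge_coord p a D m : (1 <= p)%E -> (forall i, 0 <= a i) ->
  lnorm p a <= D -> a m <= D.
Proof.
case: p => [r||//] + a0 /=; last first.
  move=> _ aD; apply: le_trans aD; rewrite -{1}(ger0_norm (a0 m)).
  exact: (le_bigmax _ (fun i => `|a i|)).
rewrite lee_fin => r1; apply: le_trans.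
have r0 : 0 < r by lra.
rewrite -{1}[a m]powRr1// -{1}(divff (lt0r_neq0 r0)) powRrM.
rewrite ge0_ler_powR ?nnegrE ?powR_ge0 ?invr_ge0 ?(ltW r0)//.
  by apply: sumr_ge0 => i _; exact: powR_ge0.
rewrite (bigD1 m)//= ger0_norm// lerDl.
by apply: sumr_ge0 => i _; exact: powR_ge0.
Qed.

Lemma hoelder_conjugate_EFin r : 1 < r ->
  hoelder_conjugate r%:E = (r / (r - 1))%:E.
Proof.
move=> r1; rewrite /hoelder_conjugate/= eqe gt_eqF; last by lra.
by rewrite -EFinB inver gt_eqF ?subr_gt0.
Qed.

Lemma hoelder_conjugate_ge1 t s : (1 <= t)%E ->
  hoelder_conjugate t = s%:E -> 1 <= s.
Proof.
case: t => [r|_|//]; last by rewrite hoelder_conjugatey => -[<-].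
rewrite lee_fin le_eqVlt => /predU1P[<-|r1].
  by rewrite hoelder_conjugate1.
rewrite hoelder_conjugate_EFin// => -[<-].
by rewrite ler_pdivlMr ?subr_gt0// mul1r gerBl.
Qed.

(* Young's inequality applied to [a m / D] and [b m / B], where [B] is the
   dual norm of [b]; as [a m <= D], raising the exponent only helps. *)
Lemma hoelder_lnorm p t a b D s : 0 < D -> (1 <= p)%E -> (p <= t)%E ->
  hoelder_conjugate t = s%:E ->
  (forall m, 0 <= a m) -> (forall m, 0 <= b m) -> lnorm p a <= D ->
  \sum_m a m * b m <= D * lnorm s%:E b.
Proof.
move=> D0 p1 pt ts a0 b0 aD.
have s1 := hoelder_conjugate_ge1 (le_trans p1 pt) ts.
have s0 : 0 < s by lra.
have acoord m : a m <= D by exact: lnorm_ge_coord aD.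
set B := lnorm _ b.
have B0 : 0 <= B by exact: powR_ge0.
have BE : \sum_m b m `^ s = B `^ s.
  rewrite /B/= -powRrM mulVf ?gt_eqF// powRr1; last first.
    by apply: sumr_ge0 => m _; exact: powR_ge0.
  by apply: eq_bigr => m _; rewrite ger0_norm.
clearbody B.
case: t => [r||] in pt ts *; last by move: (le_trans p1 pt).
  case: p => [q||//] in p1 pt aD *; last by move: pt; rewrite leye_eq.
  rewrite !lee_fin in p1 pt.
  have q0 : 0 < q by lra.
  move: (le_trans p1 pt); rewrite le_eqVlt => /predU1P[r1|r1].
    by move: ts; rewrite -r1 hoelder_conjugate1.
  (* If [B = 0], normalizing by [B] is meaningless, but then every [b m] vanishes. *)
  move: B0; rewrite le_eqVlt => /predU1P[B0|B0].
    rewrite big1 -?B0 ?mulr0// => m _; move: BE.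
    rewrite -B0 powR0 ?gt_eqF// => /eqP; rewrite psumr_eq0; last first.
      by move=> i _; exact: powR_ge0.
    move=> /allP/(_ m); rewrite mem_index_enum => /(_ isT)/eqP/powR_eq0_eq0 ->.
    by rewrite mulr0.
  move: ts; rewrite hoelder_conjugate_EFin// => -[sE].
  have rs : r^-1 + s^-1 = 1 by rewrite -sE; field; lra.
  have sumA : \sum_m (a m / D) `^ r <= 1.
    apply: (@le_trans _ _ (\sum_m (a m / D) `^ q)).
      apply: ler_sum => m _; have := a0 m; rewrite le_eqVlt => /predU1P[<-|am].
        by rewrite mul0r !powR0 ?gt_eqF//; lra.
      by rewrite ger_powR// divr_gt0//= ler_pdivrMr// mul1r.
    have -> : \sum_m (a m / D) `^ q = (\sum_m a m `^ q) / D `^ q.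
      rewrite mulr_suml; apply: eq_bigr => m _.
      rewrite powRM ?invr_ge0 ?(ltW D0)// -powR_inv1 ?(ltW D0)//.
      by rewrite powRAC powR_inv1 ?powR_ge0.
    rewrite ler_pdivrMr ?powR_gt0// mul1r.
    have -> : \sum_m a m `^ q = (lnorm q%:E a) `^ q.
      rewrite /= -powRrM mulVf ?gt_eqF// powRr1; last first.
        by apply: sumr_ge0 => m _; exact: powR_ge0.
      by apply: eq_bigr => m _; rewrite ger0_norm.
    by rewrite ge0_ler_powR ?nnegrE ?powR_ge0 ?(ltW q0) ?(ltW D0).
  have sumB : \sum_m (b m / B) `^ s = 1.
    transitivity ((\sum_m b m `^ s) / B `^ s).
      rewrite mulr_suml; apply: eq_bigr => m _.
      rewrite powRM ?invr_ge0 ?(ltW B0)// -powR_inv1 ?(ltW B0)//.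
      by rewrite powRAC powR_inv1 ?powR_ge0.
    by rewrite BE divff// gt_eqF// powR_gt0.
  have young : \sum_m (a m / D) * (b m / B) <= 1.
    rewrite -rs; apply: (@le_trans _ _
      (\sum_m ((a m / D) `^ r / r + (b m / B) `^ s / s))).
      apply: ler_sum => m _; apply: conjugate_powR => //; last by lra.
      - by rewrite divr_ge0// ltW.
      - by rewrite divr_ge0// ltW.
    rewrite big_split/= -!mulr_suml sumB mul1r lerD2r ler_pdivrMr; last by lra.
    by rewrite mulVf// gt_eqF//; lra.
  have -> : \sum_m a m * b m = (D * B) * \sum_m (a m / D) * (b m / B).
    rewrite mulr_sumr; apply: eq_bigr => m _; field.
    by rewrite !gt_eqF.
  by rewrite ler_piMr// ltW// mulr_gt0.
(* For [t = +oo] the dual exponent is 1, [B] is the plain sum of [b], and the coordinate bounds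
   [a m <= D] suffice. *)
move: ts; rewrite hoelder_conjugatey => -[sE].
have -> : B = \sum_m b m.
  rewrite -[B]powRr1// sE -BE -sE; apply: eq_bigr => m _.
  by rewrite powRr1.
rewrite mulr_sumr; apply: ler_sum => m _.
by rewrite ler_wpM2r.
Qed.

Lemma prod_dot_le (H : 'I_M -> hilbertType R) p t D s (w u : forall m, H m) :
  0 < D -> (1 <= p)%E -> (p <= t)%E -> hoelder_conjugate t = s%:E ->
  norm2 p w <= D -> prod_dot w u <= D * norm2 s%:E u.
Proof.
move=> D0 p1 pt ts wD; rewrite /prod_dot /norm2.
apply: le_trans (hoelder_lnorm D0 p1 pt ts _ _ wD) => //.
by apply: ler_sum => m _; exact: hdot_le_norm.
Qed.

End hoelder.

(** * From the integral over random signs to a finite average *)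

Section expectation.
Import HBNNSimple.
Variables (R : realType) (d : measure_display) (T : measurableType d).
Variable P : probability T R.

(* The integral of a nonnegative function is the supremum of the integrals of
   the simple functions below it, so it is monotone without measurability. *)
Lemma ge0_integral_homo (f g : T -> \bar R) :
  (forall x, 0 <= f x)%E -> (forall x, f x <= g x)%E ->
  (\int[P]_x f x <= \int[P]_x g x)%E.
Proof.
move=> f0 fg; rewrite !ge0_integralTE//; last first.
  by move=> x; exact: le_trans (fg x).
apply: ereal_sup_le => _ [h hf <-].
by exists h => // x; exact: le_trans (hf x) (fg x).
Qed.

Variables (n : nat) (sigma : 'I_n -> {RV P >-> R}).
Hypothesis hsigma : rademacher_signs sigma.
Local Notation signs := {ffun 'I_n -> bool}.

Definition sign_event (e : signs) : set T :=
  \bigcap_(i in [set` [set: 'I_n]%SET]) (sigma i @^-1` [set (-1) ^+ e i]).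

Lemma sign_eventP (e : signs) (o : T) :
  sign_event e o <-> forall i, sigma i o = (-1) ^+ e i.
Proof.
by split=> [h i|h i _]; [apply: h; rewrite /= inE | exact: h].
Qed.

Lemma measurable_sign_event (e : signs) : measurable (sign_event e).
Proof.
by apply: fin_bigcap_measurable => // i _.
Qed.

Lemma card_signs : #|{: signs}|%:R = 2 ^+ n :> R.
Proof. by rewrite card_ffun card_bool card_ord natrX. Qed.

Lemma probability_sign_event (e : signs) :
  P (sign_event e) = (#|{: signs}|%:R^-1)%:E.
Proof.
have [h1 h2] := hsigma.
rewrite /sign_event (h2 _ (fun i => [set (-1) ^+ e i])); last first.
  by move=> i; exact: measurable_set1.
rewrite (eq_bigr (fun=> (2^-1)%:E)); last first.
  by move=> i _; case: (h1 i) => p1 pN1; case: (e i); rewrite ?expr0 ?expr1.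
by rewrite prodEFin prodr_const cardsT card_ord exprVn card_signs.
Qed.

(** The [2 ^ n] sign events are pairwise disjoint and each has probability [2 ^ - n], so together
    they carry all the mass. *)
Lemma sign_event_ae : P (~` \bigcup_e sign_event e) = 0%E.
Proof.
have mU : measurable (\bigcup_e sign_event e).
  by apply: fin_bigcup_measurable => // e _; exact: measurable_sign_event.
rewrite probability_setC// measure_fin_bigcup.
- rewrite (fsbigE (index_enum signs)) ?index_enum_uniq//; last first.
    by move=> e _; rewrite mem_index_enum.
  under eq_bigl do rewrite in_setT.
  rewrite (eq_bigr (fun=> (#|{: signs}|%:R^-1)%:E)); last first.
    by move=> e _; exact: probability_sign_event.
  rewrite sumEFin sumr_const -EFinB -(mulr_natr _ #|_|) mulVf ?subrr//.
  by rewrite card_signs expf_neq0.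
- exact: finite_finset.
- move=> e f _ _ [w [/sign_eventP eo /sign_eventP fo]].
  apply/ffunP => i; have := eo i; rewrite fo.
  by case: (e i); case: (f i) => //; rewrite expr0 expr1 => h; exfalso; lra.
- by move=> e _; exact: measurable_sign_event.
Qed.

Lemma integral_signs_le (F : T -> \bar R) (G : signs -> R) :
  (forall o, 0 <= F o)%E -> (forall e, 0 <= G e) ->
  (forall (e : signs) o, (forall i, sigma i o = (-1) ^+ e i) -> (F o <= (G e)%:E)%E) ->
  (\int[P]_o F o <= (#|{: signs}|%:R^-1 * \sum_e G e)%:E)%E.
Proof.
move=> F0 G0 FG.
set N := ~` \bigcup_e sign_event e.
have mN : measurable N.
  apply: measurableC.
  by apply: fin_bigcup_measurable => // e _; exact: measurable_sign_event.
pose h e o := ((G e)%:E * (\1_(sign_event e) o)%:E)%E.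
have mi (A : set T) : measurable A ->
    measurable_fun setT ((fun o => (\1_A o)%:E) : T -> \bar R).
  by move=> mA; apply/measurable_EFinP; exact: measurable_indic.
have mh e : measurable_fun setT (h e).
  by apply: measurable_funeM; apply: mi; exact: measurable_sign_event.
have h0 e o : (0 <= h e o)%E by rewrite mule_ge0// lee_fin.
(* A supremum over a class may fail to be measurable, so [F] is dominated by a measurable function:
   [G e] on each sign event and [+oo] on the exceptional set [N]. The latter integrates to
   [+oo * 0 = 0]. *)
apply: (@le_trans _ _ (\int[P]_o (\sum_e h e o + +oo * (\1_N o)%:E))%E).
  apply: ge0_integral_homo => // o.
  have [[e _ eo]|No] := pselect ((\bigcup_e sign_event e) o).
    apply: (@le_trans _ _ (h e o)).
      by rewrite /h indicE mem_set// mule1; apply: FG; exact/sign_eventP.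
    rewrite (bigD1 e)//= -addeA; apply: leeDl; apply: adde_ge0.
      by apply: sume_ge0.
    by rewrite mule_ge0// lee_fin.
  rewrite [X in (_ + +oo * X)%E](_ : _ = 1%E); last by rewrite indicE mem_set.
  rewrite mule1 addey ?leey// gt_eqF// (@lt_le_trans _ _ 0%E)// ?ltNyr//.
  by apply: sume_ge0.
rewrite ge0_integralD//; last 3 first.
- by move=> o _; apply: sume_ge0.
- exact: emeasurable_sum.
- by apply: measurable_funeM; exact: mi.
rewrite ge0_integralZl//; last exact: mi.
rewrite integral_indic// setIT [X in (+oo * X)%E](_ : _ = 0%E); last first.
  exact: sign_event_ae.
rewrite mule0 adde0 ge0_integral_sum//.
rewrite mulr_sumr -sumEFin lee_sum// => e _.
rewrite ge0_integralZl ?lee_fin//; last first.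
  by apply: mi; exact: measurable_sign_event.
rewrite integral_indic//; last exact: measurable_sign_event.
by rewrite setIT [X in (_ * X)%E]probability_sign_event -EFinM mulrC.
Qed.

End expectation.

(** * The average dual norm of the signed mean *)

Section sign_average.
Variables (R : realType) (M n : nat) (H : 'I_M -> hilbertType R).
Variable x : 'I_n -> forall m, H m.
Local Notation signs := {ffun 'I_n -> bool}.

Lemma tr_normalized_gram m :
  \tr (normalized_gram x m) = n%:R^-1 * \sum_i `|x i m| ^+ 2.
Proof.
by rewrite mulr_sumr; apply: eq_bigr => i _; rewrite mxE hdot_norm.
Qed.

Lemma signed_mean_sum (e : signs) m :
  signed_mean x (fun i => (-1) ^+ e i) m =
  signed_sum (fun i => n%:R^-1 *: x i m) e.
Proof.
rewrite /signed_mean scaler_sumr; apply: eq_bigr => i _.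
by rewrite !scalerA mulrC.
Qed.

(** Jensen for the exponent [1 / s] moves the average inside the root; Khintchine-Kahane then
    applies in each space to the vectors [x i m / n], whose squared norms add up to the trace
    divided by [n]. *)
Lemma mean_norm2_signed_mean (s : R) : 1 <= s ->
  #|{: signs}|%:R^-1 *
    \sum_(e : signs) norm2 s%:E (signed_mean x (fun i => (-1) ^+ e i)) <=
  Num.sqrt (s / n%:R * lnorm (s / 2)%:E (fun m => \tr (normalized_gram x m))).
Proof.
move=> s1; have s0 : 0 < s by lra.
have tr0 m : 0 <= \tr (normalized_gram x m).
  by rewrite tr_normalized_gram mulr_ge0 ?invr_ge0//; exact: sumr_ge0.
have c0 : (0 < #|{: signs}|)%N by apply/card_gt0P; exists [ffun=> false].
have sn0 : 0 <= s / n%:R by rewrite divr_ge0// ltW.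
pose f (e : signs) := \sum_m `|signed_mean x (fun i => (-1) ^+ e i) m| `^ s.
have f0 e : 0 <= f e by apply: sumr_ge0 => m _; exact: powR_ge0.
have norm2E (e : signs) :
    norm2 s%:E (signed_mean x (fun i => (-1) ^+ e i)) = f e `^ s^-1.
  by congr (_ `^ _); apply: eq_bigr => m _; rewrite normr_id.
under eq_bigr do rewrite norm2E.
have s10 : 0 <= s^-1 <= 1 by rewrite invr_ge0 (ltW s0) invf_le1.
apply: le_trans (power_mean c0 f0 s10) _.
have fle : #|{: signs}|%:R^-1 * \sum_e f e <=
    (s / n%:R) `^ (s / 2) * \sum_m \tr (normalized_gram x m) `^ (s / 2).
  rewrite exchange_big/= !mulr_sumr; apply: ler_sum => m _.
  under eq_bigr do rewrite signed_mean_sum.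
  apply: le_trans (khintchine _ s1) _.
  rewrite -powRM// (_ : s * _ = s / n%:R * \tr (normalized_gram x m))//.
  rewrite tr_normalized_gram -mulrA; congr (_ * _).
  rewrite !mulr_sumr; apply: eq_bigr => i _.
  by rewrite normrZ exprMn [in LHS]ger0_norm ?invr_ge0// expr2 -mulrA.
have S0 : 0 <= \sum_m \tr (normalized_gram x m) `^ (s / 2).
  by apply: sumr_ge0 => m _; exact: powR_ge0.
apply: le_trans (ge0_ler_powR _ _ _ fle) _.
- by rewrite invr_ge0 ltW.
- rewrite nnegrE; apply: mulr_ge0; first by rewrite invr_ge0.
  exact: sumr_ge0.
- by rewrite nnegrE mulr_ge0 ?powR_ge0.
rewrite powRM ?powR_ge0// -powRrM -powR12_sqrt; last first.
  by rewrite mulr_ge0// powR_ge0.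
rewrite [in leRHS]powRM ?powR_ge0//= -powRrM.
(* The factor [s / n] ends with exponent [1 / 2], and the sum of trace powers with exponent [1 / s],
   which is half the outer exponent [2 / s] of the [lnorm] of order [s / 2]. *)
rewrite (_ : s / 2 * s^-1 = 2^-1); last by field; rewrite gt_eqF.
rewrite (_ : (s / 2)^-1 / 2 = s^-1); last by field; rewrite gt_eqF.
by under [in leRHS]eq_bigr do rewrite ger0_norm//.
Qed.

End sign_average.

(** * The complexity bound for the multi-kernel class *)

Lemma norm2_cst0 (R : realType) (M : nat) (H : 'I_M -> hilbertType R)
    (p : \bar R) : (1 <= p)%E -> norm2 p (fun m => 0 : H m) = 0.
Proof.
rewrite /norm2; case: p => [q||//] /=.
  rewrite lee_fin => q1; rewrite big1 ?powR0 ?invr_eq0 ?gt_eqF//; first lra.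
  by move=> m _; rewrite normr0 normr0 powR0// gt_eqF//; lra.
move=> _; elim/big_ind : _ => // [a b -> ->|m _]; first by rewrite maxxx.
by rewrite !normr0.
Qed.

Theorem proposition2 (R : realType) (M n : nat) (hM : (0 < M)%N) (hn : (0 < n)%N)
    (H : 'I_M -> hilbertType R) (x : 'I_n -> forall m, H m)
    (d : measure_display) (T : measurableType d) (P : probability T R)
    (sigma : 'I_n -> {RV P >-> R}) (hsigma : rademacher_signs sigma)
    (p : \bar R) (hp : (1 <= p)%E) (D : R) (hD : 0 < D)
    (t : \bar R) (hpt : (p <= t)%E) :
  (empirical_rademacher sigma x (multi_kernel_class H p D) <=
   match hoelder_conjugate t with
   | ts%:E =>
       (D * Num.sqrt (ts / n%:R *
          lnorm (ts / 2)%:E (fun m => \tr (normalized_gram x m))))%:E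
   | _ => +oo
   end)%E.
Proof.
case ts : (hoelder_conjugate t) => [s||]; [|exact: leey|exact: leey].
have s1 := hoelder_conjugate_ge1 (le_trans hp hpt) ts.
pose G (e : {ffun 'I_n -> bool}) :=
  D * norm2 s%:E (signed_mean x (fun i => (-1) ^+ e i)).
apply: (@le_trans _ _
    (#|{: {ffun 'I_n -> bool}}|%:R^-1 * \sum_e G e)%:E); last first.
  rewrite lee_fin -mulr_sumr mulrCA ler_pM2l//.
  exact: mean_norm2_signed_mean.
apply: (integral_signs_le hsigma).
(* The zero predictor lies in the class, so the supremum is nonnegative. *)
- move=> o; apply: le_ereal_sup_tmp; exists 0%E => //.
  exists (linear_predictor (fun m => 0 : H m)).
    by exists (fun m => 0) => //=; rewrite norm2_cst0// ltW.
  rewrite /linear_predictor /prod_dot big1// => m _.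
  exact: linear0l.
- by move=> e; rewrite mulr_ge0 ?powR_ge0// ltW.
- move=> e o eo; apply: ge_ereal_sup => _ [_ [w wD <-] <-].
  rewrite lee_fin /linear_predictor (_ : (fun i => sigma i o) =
    (fun i => (-1) ^+ e i)); last exact/funext.
  exact: prod_dot_le hp hpt ts wD.
Qed.
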